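(* Let $M\ge 3$ and, for $s\ge 2$, let $V(s)$ denote the speed, i.e. the almost sure limit $\lim_{t\to\infty}d(o,S_{1,t})/t$, of the $2$-leg spider walk with span bounded by $s$ for the continuous-time simple random walk on the homogeneous tree $\mathbb T_M$. Then $V(s)\to 0$ as $s\to\infty$.
   Context: $\mathbb T_M$ is the infinite tree in which every vertex has degree $M$, with root $o$ and graph distance $d$. The continuous-time simple random walk has rate $1$ to each neighbour. The $2$-leg spider walk with span bounded by $s$ is the continuous-time Markov process $S_t=(S_{1,t},S_{2,t})$ on $\{(x_1,x_2): x_1\ne x_2,\ d(x_1,x_2)\le s\}$ in which each leg jumps to each neighbouring vertex at rate $1$, a jump being performed only if afterwards the two legs are on distinct vertices at distance at most $s$ (otherwise it is suppressed). *)

(* Defs.v *)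
From HB Require Import structures.
From mathcomp Require Import all_boot all_order all_algebra.
From mathcomp Require Import all_classical all_reals all_analysis.
Set Implicit Arguments. Unset Strict Implicit. Unset Printing Implicit Defensive.
Import Order.TTheory GRing.Theory Num.Theory.
Import numFieldNormedType.Exports.
Local Open Scope classical_set_scope.
Local Open Scope ring_scope.

(* The homogeneous tree T_M.  Vertices are reduced words over 'I_M     *)
(* (no two consecutive equal letters), written with the MOST RECENT    *)
(* letter at the head.  The root o is the empty word.  The parent of   *)
(* a :: w is w; the children of a :: w are b :: a :: w with b != a;    *)
(* the children of the root are [:: b] for all b.  Every vertex thus   *)
(* has degree M.                                                       *)

Definition reduced (M : nat) (w : seq 'I_M) : bool :=
  sorted (fun a b : 'I_M => a != b) w.

Definition nbrs (M : nat) (w : seq 'I_M) : seq (seq 'I_M) :=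
  match w with
  | [::] => [seq [:: b] | b <- enum 'I_M]
  | a :: w' => w' :: [seq b :: w | b <- enum 'I_M & b != a]
  end.

Definition root_vertex (M : nat) : seq 'I_M := [::].

Fixpoint lcp (M : nat) (x y : seq 'I_M) : nat :=
  match x, y with
  | a :: x', b :: y' => if a == b then (lcp x' y').+1 else 0%N
  | _, _ => 0%N
  end.

(* graph distance in the tree: the common ancestor of x and y is their
   longest common suffix (= common prefix of the root-to-vertex paths) *)
Definition tdist (M : nat) (x y : seq 'I_M) : nat :=
  (size x + size y - 2 * lcp (rev x) (rev y))%N.

Definition conf (M : nat) := (seq 'I_M * seq 'I_M)%type.

Definition valid_conf (M s : nat) (c : conf M) : bool :=
  [&& reduced c.1, reduced c.2, c.1 != c.2 & (tdist c.1 c.2 <= s)%N].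

(* the list of allowed (non-suppressed) jumps from c; each has rate 1 *)
Definition moves (M s : nat) (c : conf M) : seq (conf M) :=
  [seq (y, c.2) | y <- [seq y <- nbrs c.1 | (y != c.2) && (tdist y c.2 <= s)%N]]
  ++ [seq (c.1, y) | y <- [seq y <- nbrs c.2 | (c.1 != y) && (tdist c.1 y <= s)%N]].

(* Q^n (x, y), Q the generator: Q(c,c') = #{allowed jumps c -> c'} for
   c' != c, Q(c,c) = - #{allowed jumps from c}. *)
Fixpoint Qpow (R : ringType) (M s : nat) (n : nat) (c c' : conf M) : R :=
  match n with
  | 0%N => (c == c')%:R
  | n.+1 => - (size (moves s c))%:R * Qpow R s n c c'
            + \sum_(z <- moves s c) Qpow R s n z c'
  end.

(* transition function P_t = exp (t Q) (rates are bounded, so the series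
   converges) *)
Definition trans (R : realType) (M s : nat) (t : R) (c c' : conf M) : R :=
  limn (series (fun n : nat => t ^+ n / (n`!)%:R * Qpow R s n c c')).

Definition spider_walk (R : realType) (d : measure_display)
    (Omega : measurableType d) (P : probability Omega R) (M s : nat)
    (x0 : conf M) (S : R -> Omega -> conf M) : Prop :=
  [/\ valid_conf s x0,
      (forall t y, 0 <= t -> measurable [set w | S t w = y]),
      (forall w t, 0 <= t -> exists2 e : R, 0 < e &
          forall u, t <= u < t + e -> S u w = S t w) &
      (forall (ts : seq R) (ys : seq (conf M)), size ts = size ys ->
          sorted <=%R (0 :: ts) ->
          P [set w | forall i, (i < size ts)%N -> S (nth 0 ts i) w = nth x0 ys i]
          = (\prod_(i < size ts)
               trans s (nth 0 (0 :: ts) i.+1 - nth 0 (0 :: ts) i)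
                       (nth x0 (x0 :: ys) i) (nth x0 (x0 :: ys) i.+1))%:E)].

(* Main.v *)
Require Import Defs.
From HB Require Import structures.
From mathcomp Require Import all_boot all_order all_algebra.
From mathcomp Require Import all_classical all_reals all_analysis.
From mathcomp Require Import measurable_realfun zify ring lra.
Import Order.TTheory GRing.Theory Num.Theory.
Import numFieldNormedType.Exports.
Local Open Scope classical_set_scope.
Local Open Scope ring_scope.

(** Let p be the projection of the root onto the geodesic joining the two legs,
and let a, b be the distances of the legs to p.  While a and b are positive, p
does not move and u = a - b is a martingale.  When a leg is at p, away from the
root, |p| has drift at most 0 unless the spider is fully stretched, |u| = s, in
which case it is 1; but then the suppressed jumps push |u| inwards at rate 2,
so that u^2 / (4s) has drift about -1 and compensates.  The root pushes |p|
outwards as well, so |p| is flattened near the root, into sqrt(|p|^2 + s^2).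
Hence the function sqrt(|p|^2 + s^2) + u^2 / (4s) has drift at most (M + 2) / s
everywhere.  As it dominates |x_1| up to the constant s, the mean of |S_1,t| / t
is asymptotically at most (M + 2) / s, and by Fatou's lemma so is the speed.

The passage from the drift to the mean uses that exp (t Q) is the limit of the
Euler schemes (1 + (t / m) Q)^m, which are positive operators for m large. *)

Set Implicit Arguments. Unset Strict Implicit. Unset Printing Implicit Defensive.

(** * Reduced words and distances *)

Section Tree.
Context (M : nat).
Implicit Types (p q x y z : seq 'I_M).

Lemma lcpC p q : lcp p q = lcp q p.
Proof.
elim: p q => [|a p IH] [|b q] //=.
by rewrite eq_sym; case: eqP => // _; rewrite IH.
Qed.

Lemma lcp_size p q : (lcp p q <= size p)%N.
Proof. by elim: p q => [|a p IH] [|b q] //=; case: eqP => // _; apply: IH. Qed.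

Lemma lcp_prefix p q : prefix p q = (lcp p q == size p).
Proof.
elim: p q => [|a p IH] [|b q] //=.
by case: eqP => // _; rewrite IH eqSS.
Qed.

Lemma lcp_rcons p q a : lcp (rcons p a) q = (lcp p q + prefix (rcons p a) q)%N.
Proof.
elim: p q => [|b p IH] [|c q] //=.
  by case: eqP => // _; rewrite prefix0s.
by case: eqP => // _; rewrite IH.
Qed.

Lemma prefix_rconsW p q a : prefix (rcons p a) q -> prefix p q.
Proof.
move/prefixP => [r ->]; apply/prefixP; exists (a :: r).
by rewrite cat_rcons.
Qed.

(* The depth of the projection of the root onto the geodesic from [x] to [y]. *)
Definition confl x y := lcp (rev x) (rev y).

Lemma conflC x y : confl x y = confl y x.
Proof. exact: lcpC. Qed.

Lemma confl_sizel x y : (confl x y <= size x)%N.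
Proof. by rewrite -size_rev lcp_size. Qed.

Lemma confl_sizer x y : (confl x y <= size y)%N.
Proof. by rewrite conflC confl_sizel. Qed.

Lemma tdistE x y : tdist x y = (size x + size y - 2 * confl x y)%N.
Proof. by []. Qed.

Lemma tdistC x y : tdist x y = tdist y x.
Proof. by rewrite !tdistE conflC addnC. Qed.

Lemma tdist_root x : tdist (root_vertex M) x = size x.
Proof. by rewrite tdistE /confl /= muln0 subn0. Qed.

Lemma tdist_gt0 x y : (0 < tdist x y)%N = (x != y).
Proof.
have := confl_sizel x y; have := confl_sizer x y.
have [<-|nxy] := eqVneq x y.
  have : lcp (rev x) (rev x) == size (rev x) by rewrite -lcp_prefix prefix_refl.
  rewrite size_rev tdistE /confl => /eqP ->; lia.
move=> h1 h2; rewrite lt0n; apply: contra nxy => /eqP D0.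
move: D0; rewrite tdistE => D0.
(* [confl] is at most either size, so a vanishing distance, even under truncated subtraction, forces
   both sizes to equal it. *)
have e1 : confl x y = size x by lia.
have e2 : confl x y = size y by lia.
have : prefix (rev x) (rev y) by rewrite lcp_prefix size_rev -e1.
move/prefixP=> [r er].
have : size r = 0%N.
  have := congr1 size er; rewrite size_cat !size_rev -e1 -e2 => /eqP.
  by rewrite -[X in X == _]addn0 eqn_add2l => /eqP.
move=> /size0nil r0; move: er; rewrite r0 cats0 => /(congr1 rev).
by rewrite !revK => ->.
Qed.

(** The prefix test asks whether the child [a :: x] is [y] or an ancestor of [y]; only then does the
    projection follow the step. *)
Lemma confl_cons x y a : confl (a :: x) y = (confl x y + prefix (rev (a :: x)) (rev y))%N.
Proof. by rewrite /confl rev_cons lcp_rcons. Qed.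

Lemma mem_nbrs_reduced x z : reduced x -> z \in nbrs x -> reduced z.
Proof.
case: x => [|a x] /= rx.
  by move=> /mapP[b _ ->].
rewrite inE => /orP[/eqP ->|/mapP[b]].
  by move: rx; rewrite /reduced /=; apply: path_sorted.
by rewrite mem_filter => /andP[ba _] ->; rewrite /reduced /= ba.
Qed.

Lemma size_nbrs x : (0 < M)%N -> size (nbrs x) = M.
Proof.
case: x => [|a x] M0 /=; first by rewrite size_map size_enum_ord.
rewrite size_map size_filter; have := count_predC (pred1 a) (enum 'I_M).
rewrite size_enum_ord count_uniq_mem ?enum_uniq // mem_enum /=.
by rewrite add1n.
Qed.

Lemma size_moves s (c : conf M) : (0 < M)%N -> (size (moves s c) <= 2 * M)%N.
Proof.
move=> M0; rewrite size_cat !size_map !size_filter mul2n -addnn.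
by apply: leq_add; apply: (leq_trans (count_size _ _)); rewrite size_nbrs.
Qed.

Lemma moves_valid s (c z : conf M) : valid_conf s c -> z \in moves s c -> valid_conf s z.
Proof.
case: c => x y /and4P[/= rx ry nxy D]; rewrite mem_cat => /orP[] /mapP[t];
  rewrite mem_filter /= => /andP[/andP[h1 h2] h3] ->; rewrite /valid_conf /=.
  by rewrite (mem_nbrs_reduced rx h3) ry h1 h2.
by rewrite (mem_nbrs_reduced ry h3) rx h1 h2.
Qed.

(** * Sums over the allowed jumps *)

Context (R : comRingType).

(** Both legs get a condition of the same form, with distinctness as a positive distance, so that
    arithmetic on lengths decides which jumps are allowed. *)
Lemma sum_moves s x y (G : conf M -> R) :
  \sum_(z <- moves s (x, y)) G z =
  \sum_(z <- nbrs x | (0 < tdist z y <= s)%N) G (z, y) +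
  \sum_(z <- nbrs y | (0 < tdist z x <= s)%N) G (x, z).
Proof.
rewrite big_cat !big_map !big_filter /=; congr (_ + _).
  by apply: eq_bigl => z; rewrite tdist_gt0.
by apply: eq_bigl => z; rewrite tdist_gt0 eq_sym tdistC.
Qed.

Lemma sum_cond_const (I : Type) (l : seq I) (b : bool) (v : R) :
  \sum_(i <- l | b) v = b%:R * (size l)%:R * v.
Proof.
case: b; last by rewrite big_pred0_eq !mul0r.
by rewrite mul1r big_const_seq count_predT iter_addr_0 mulr_natl.
Qed.

(** As [x] is neither [y] nor an ancestor of [y], the path to [y] starts at the parent of [x]: the
    parent is one step nearer, the [M.-1] children one step farther, and the projection stays. For
    fixed [y], the potential depends only on the two arguments of [H]. *)
Lemma sum_nbrs_away s x y (H : nat -> nat -> R) :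
  (tdist x y <= s)%N -> ~~ prefix (rev x) (rev y) ->
  \sum_(z <- nbrs x | (0 < tdist z y <= s)%N) H (size z) (confl z y) =
  (1 < tdist x y)%N%:R * H (size x).-1 (confl x y) +
  (tdist x y < s)%N%:R * M.-1%:R * H (size x).+1 (confl x y).
Proof.
case: x => [|a x] Ds npre; first by rewrite prefix0s in npre.
have M0 : (0 < M)%N by case: (a) => k; case: (M).
have mx : confl x y = confl (a :: x) y by rewrite confl_cons (negbTE npre) addn0.
have mb b : confl [:: b, a & x] y = confl (a :: x) y.
  rewrite confl_cons; case: (boolP (prefix _ _)); last by rewrite addn0.
  by rewrite rev_cons => /prefix_rconsW; rewrite (negbTE npre).
have := confl_sizel x y; have := confl_sizer x y; rewrite mx => ley lex.
rewrite /= big_cons mx.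
have -> : (0 < tdist x y <= s)%N = (1 < tdist (a :: x) y)%N.
  by move: Ds; rewrite !tdistE mx /=; lia.
have -> : \sum_(z <- [seq b :: a :: x | b <- enum 'I_M & b != a] |
     (0 < tdist z y <= s)%N) H (size z) (confl z y) =
  (tdist (a :: x) y < s)%N%:R * M.-1%:R * H (size x).+2 (confl (a :: x) y).
  rewrite big_map (eq_big (fun=> (tdist (a :: x) y < s)%N)
    (fun=> H (size x).+2 (confl (a :: x) y))); last 2 first.
  - by move=> b; rewrite !tdistE mb /=; lia.
  - by move=> b _; rewrite mb.
  rewrite sum_cond_const; congr (_ * _%:R * _).
  by have /(congr1 predn) := size_nbrs (a :: x) M0; rewrite /= size_map.
by case: ltnP; rewrite ?mul1r ?mul0r ?add0r.
Qed.

(* Exactly one neighbour of [x] lies on the geodesic to [y], and it is a child. *)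
Lemma sum_nbrs_toward s x y (H : nat -> nat -> R) :
  reduced y -> x != y -> (tdist x y <= s)%N -> prefix (rev x) (rev y) ->
  \sum_(z <- nbrs x | (0 < tdist z y <= s)%N) H (size z) (confl z y) =
  ((0 < size x) && (tdist x y < s))%N%:R * H (size x).-1 (confl x y).-1 +
  (1 < tdist x y)%N%:R * H (size x).+1 (confl x y).+1 +
  (tdist x y < s)%N%:R * (M.-1 - (0 < size x))%N%:R * H (size x).+1 (confl x y).
Proof.
move=> ry nxy Ds pxy.
have mxE : confl x y = size x by apply/eqP; rewrite -[size x]size_rev -lcp_prefix.
(* [e] is the letter of the child of [x] on the geodesic to [y]. *)
have [e [r yE]] : exists e r, y = r ++ e :: x.
  move: pxy => /prefixP[r /(congr1 rev)]; rewrite rev_cat !revK.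
  case: (lastP (rev r)) => [|r' e] yE; first by rewrite yE eqxx in nxy.
  by exists e, r'; rewrite yE cat_rcons.
have mb b : confl (b :: x) y = (size x + (b == e))%N.
  rewrite confl_cons mxE yE rev_cat !rev_cons -!cats1 -catA prefix_catr // eqxx /=.
  by rewrite prefix0s andbT.
have ex : if x is a :: _ then e != a else true.
  case: (x) yE => // a x' yE; move: ry.
  by rewrite yE /reduced => /cat_sorted2[_ /andP[]].
have le1 : (size x < size y)%N by rewrite yE size_cat /=; lia.
have M0 : (0 < M)%N by case: (e) => k; case: (M).
(* The letters of the children of [x]. Only at the root is no letter excluded, whence
   [M.-1 - (0 < size x)] of them after removing [e]. *)
set l := [seq b <- enum 'I_M | if x is a :: _ then b != a else true].
have ul : uniq l by rewrite filter_uniq // enum_uniq.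
have el : e \in l by rewrite mem_filter mem_enum; case: (x) ex => [|a x'] //= ->.
have sl : size (rem e l) = (M.-1 - (0 < size x))%N.
  rewrite size_rem //; have := size_nbrs x M0; rewrite /l.
  case: (x) => [|a x'] /=; last by rewrite size_map => /(congr1 predn) /= <-; rewrite subn1.
  by rewrite size_map subn0 filter_predT => ->.
have -> : \sum_(z <- nbrs x | (0 < tdist z y <= s)%N) H (size z) (confl z y) =
   ((0 < size x) && (tdist x y < s))%N%:R * H (size x).-1 (confl x y).-1 +
   \sum_(b <- l | (0 < tdist (b :: x) y <= s)%N) H (size x).+1 (confl (b :: x) y).
  rewrite /l; case: (x) pxy mxE le1 => [|a x'] pxy mxE le1.
    by rewrite mul0r add0r big_map filter_predT.
  have mE : confl x' y = size x'.
    by have := confl_cons x' y a; rewrite pxy mxE /= addn1 => -[].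
  rewrite /= big_cons big_map mxE mE /=.
  have -> : (0 < tdist x' y <= s)%N = (tdist (a :: x') y < s)%N.
    by move: le1; rewrite !tdistE mxE mE /=; lia.
  by case: ltnP; rewrite ?mul1r ?mul0r ?add0r.
rewrite -addrA; congr (_ + _).
rewrite (perm_big _ (perm_to_rem el)) big_cons.
have -> : (0 < tdist (e :: x) y <= s)%N = (1 < tdist x y)%N.
  by move: le1 Ds; rewrite !tdistE mb mxE eqxx /=; lia.
have -> : \sum_(b <- rem e l | (0 < tdist (b :: x) y <= s)%N) H (size x).+1 (confl (b :: x) y)
   = \sum_(b <- rem e l | (tdist x y < s)%N) H (size x).+1 (confl x y).
  rewrite big_seq_cond [RHS]big_seq_cond; apply: eq_big => b.
    rewrite mem_rem_uniq // inE; case: eqP => //= /eqP be; case: (b \in l) => //=.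
    by move: le1; rewrite !tdistE mb mxE (negbTE be) /=; lia.
  by rewrite mem_rem_uniq // inE => /andP[/andP[/= be _] _]; rewrite mb mxE (negbTE be) addn0.
rewrite sum_cond_const sl mb eqxx mxE addn1.
by case: ltnP => _; rewrite ?mul1r ?mul0r ?add0r.
Qed.
End Tree.

(** * A function of small drift *)

Section Drift.
Context (R : rcfType).

(** Concavity: the gap between the tangent at [a] and the root is a square over a positive
    number. *)
Lemma sqrt_le_tangent (a e : R) : 0 < a -> 0 <= a + e ->
  Num.sqrt (a + e) <= Num.sqrt a + e / (2 * Num.sqrt a).
Proof.
move=> a0 ae0; set b := Num.sqrt a; set t := Num.sqrt _.
have b0 : 0 < b by rewrite sqrtr_gt0.
have bE : b ^+ 2 = a by rewrite sqr_sqrtr // ltW.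
have tE : t ^+ 2 = a + e by rewrite sqr_sqrtr.
have -> : e = t ^+ 2 - b ^+ 2 by rewrite tE bE; ring.
rewrite -subr_ge0.
have -> : b + (t ^+ 2 - b ^+ 2) / (2 * b) - t = (t - b) ^+ 2 / (2 * b).
  by field; rewrite gt_eqF.
by rewrite divr_ge0 ?sqr_ge0 // mulr_ge0 // ltW.
Qed.

(** A hyperbola asymptotic to [n] that bends on the scale [s]: its slope is at most 1, while its
    first step and its second differences are at most [1 / s]. *)
Definition softabs (s n : nat) : R := Num.sqrt (n%:R ^+ 2 + s%:R ^+ 2).

Lemma softabs_ge s n : n%:R <= softabs s n.
Proof.
rewrite -[leLHS]ger0_norm ?ler0n // -sqrtr_sqr ler_wsqrtr //.
by rewrite lerDl sqr_ge0.
Qed.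

Lemma softabs_ge_scale s n : s%:R <= softabs s n.
Proof.
rewrite -[leLHS]ger0_norm ?ler0n // -sqrtr_sqr ler_wsqrtr //.
by rewrite lerDr sqr_ge0.
Qed.

Lemma softabs_nondecr s n : softabs s n <= softabs s n.+1.
Proof.
rewrite ler_wsqrtr // lerD2r ler_sqr ?nnegrE ?ler0n //.
by rewrite ler_nat.
Qed.

Lemma softabs_sqr s n : softabs s n ^+ 2 = n%:R ^+ 2 + s%:R ^+ 2.
Proof. by rewrite sqr_sqrtr // addr_ge0 ?sqr_ge0. Qed.

Lemma softabs_slope s n : softabs s n.+1 <= softabs s n + 1.
Proof.
have h := softabs_ge s n; have n0 := ler0n R n.
rewrite -[leRHS]ger0_norm; last lra.
rewrite -sqrtr_sqr ler_wsqrtr // sqrrD softabs_sqr -natr1; nra.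
Qed.

Lemma softabs_slope0 s : (0 < s)%N -> softabs s 1 <= softabs s 0 + 1 / s%:R.
Proof.
move=> s0; have sp : 0 < s%:R :> R by rewrite ltr0n.
have sE : softabs s 0 = s%:R.
  by rewrite /softabs expr0n add0r sqrtr_sqr ger0_norm.
rewrite {1}/softabs expr1n addrC.
apply: le_trans (sqrt_le_tangent _ _) _; rewrite ?exprn_gt0 ?addr_ge0 ?sqr_ge0 //.
rewrite sE sqrtr_sqr (ger0_norm (ltW sp)) lerD2l ler_pM2l // lef_pV2 ?posrE //; nra.
Qed.

(** The tangent at [n.+1] bounds both outer values; the linear parts cancel and leave the inverse of
    the middle value, which is at least [s]. *)
Lemma softabs_second_diff s n : (0 < s)%N ->
  softabs s n + softabs s n.+2 <= 2 * softabs s n.+1 + 1 / s%:R.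
Proof.
move=> s0; have sp : 0 < s%:R :> R by rewrite ltr0n.
set b := softabs s n.+1.
have b0 : 0 < b by apply: lt_le_trans sp (softabs_ge_scale _ _).
have bsE : b = Num.sqrt (n.+1%:R ^+ 2 + s%:R ^+ 2) by [].
have q0 : 0 < n.+1%:R ^+ 2 + s%:R ^+ 2 :> R by rewrite ltr_wpDl ?sqr_ge0 ?exprn_gt0.
have h1 : softabs s n <= b + (1 - 2 * n.+1%:R) / (2 * b).
  rewrite /softabs; have e : n%:R ^+ 2 + s%:R ^+ 2 = n.+1%:R ^+ 2 + s%:R ^+ 2 + (1 - 2 * n.+1%:R) :> R.
    by rewrite -natr1; ring.
  by rewrite e bsE; apply: sqrt_le_tangent => //; rewrite -e addr_ge0 ?sqr_ge0.
have h2 : softabs s n.+2 <= b + (1 + 2 * n.+1%:R) / (2 * b).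
  rewrite /softabs; have e : n.+2%:R ^+ 2 + s%:R ^+ 2 = n.+1%:R ^+ 2 + s%:R ^+ 2 + (1 + 2 * n.+1%:R) :> R.
    by rewrite -(natr1 n.+1); ring.
  by rewrite e bsE; apply: sqrt_le_tangent => //; rewrite -e addr_ge0 ?sqr_ge0.
apply: le_trans (lerD h1 h2) _.
have -> : b + (1 - 2 * n.+1%:R) / (2 * b) + (b + (1 + 2 * n.+1%:R) / (2 * b)) = 2 * b + 1 / b.
  by field; rewrite gt_eqF.
by rewrite lerD2l ler_pM2l // lef_pV2 ?posrE // softabs_ge_scale.
Qed.

(* The legs are at distances [a] and [b] from the projection of the root onto
   the geodesic joining them, and [|x1| - |x2| = a - b]. *)
Definition potential (M s : nat) (c : conf M) : R :=
  softabs s (confl c.1 c.2) + ((size c.1)%:R - (size c.2)%:R) ^+ 2 / (4 * s%:R).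

(** * Drift of the potential *)

Context (M s : nat).
Context (M1 : (1 < M)%N) (s0 : (0 < s)%N).

Lemma potentialC (x y : seq 'I_M) : potential s (x, y) = potential s (y, x).
Proof. by rewrite /potential /= conflC -sqrrN opprB. Qed.

Definition leg_drift (x y : seq 'I_M) : R :=
  \sum_(z <- nbrs x | (0 < tdist z y <= s)%N) (potential s (z, y) - potential s (x, y)).

(** Both legs are strictly below the projection, so only the squared difference changes. Jumps of
    one leg are matched by opposite changes from the other under the same span condition; the linear
    terms cancel, and each of at most [2 * M] jumps costs [1 / (4 * s)]. *)
Lemma drift_away (x y : seq 'I_M) : (tdist x y <= s)%N ->
  ~~ prefix (rev x) (rev y) -> ~~ prefix (rev y) (rev x) ->
  leg_drift x y + leg_drift y x <= (M%:R + 2) / s%:R.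
Proof.
have sp : 0 < s%:R :> R by rewrite ltr0n.
move=> Ds nxy nyx; rewrite /leg_drift.
have Es : (tdist y x <= s)%N by rewrite tdistC.
rewrite (sum_nbrs_away (fun i n => softabs s n + (i%:R - (size y)%:R) ^+ 2 / (4 * s%:R) - potential s (x, y)) Ds nxy).
rewrite (sum_nbrs_away (fun i n => softabs s n + (i%:R - (size x)%:R) ^+ 2 / (4 * s%:R) - potential s (y, x)) Es nyx).
rewrite (tdistC y x) /potential /= (conflC y x).
have x0 : (0 < size x)%N by move: nxy; case: (x) => //; rewrite prefix0s.
have y0 : (0 < size y)%N by move: nyx; case: (y) => //; rewrite prefix0s.
case: (size x) x0 => // i _; case: (size y) y0 => // j _ /=.
have -> : M%:R = M.-1%:R + 1 :> R by rewrite natr1 prednK // ltnW.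
have -> : s%:R^-1 = 4 * (4 * s%:R)^-1 :> R by field; rewrite gt_eqF.
have : 0 < (4 * s%:R)^-1 :> R by rewrite invr_gt0 mulr_gt0.
set k := (4 * _)^-1 => k0.
rewrite -!natr1; set a := i%:R; set b := j%:R; set m := M.-1%:R.
have m0 : 0 <= m := ler0n _ _.
have km : 0 <= k * m by rewrite mulr_ge0 // ltW.
by case: (ltnP 1); case: (ltnP _ s) => _ _ /=; rewrite ?mulr1n ?mulr0n; lra.
Qed.

(** Here [x] is the projection itself. Off the root and with no jump suppressed, its moves up and
    down cost a second difference of [softabs], and the terms linear in the distance cancel. The
    other cases are the root, the stretched spider and adjacent legs. *)
Lemma drift_toward (x y : seq 'I_M) : reduced y -> x != y -> (tdist x y <= s)%N ->
  prefix (rev x) (rev y) ->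
  leg_drift x y + leg_drift y x <= (M%:R + 2) / s%:R.
Proof.
have sp : 0 < s%:R :> R by rewrite ltr0n.
move=> ry xny Ds pxy; rewrite /leg_drift.
have Es : (tdist y x <= s)%N by rewrite tdistC.
have mE : confl x y = size x by apply/eqP; rewrite -[size x]size_rev -lcp_prefix.
have D0 : (0 < tdist x y)%N by rewrite tdist_gt0.
have jE : size y = (size x + tdist x y)%N.
  by have := confl_sizer x y; rewrite tdistE mE; lia.
have nyx : ~~ prefix (rev y) (rev x).
  by rewrite lcp_prefix lcpC size_rev -/(confl x y) mE jE; lia.
rewrite (sum_nbrs_toward (fun i n => softabs s n + (i%:R - (size y)%:R) ^+ 2 / (4 * s%:R) - potential s (x, y)) ry xny Ds pxy).
rewrite (sum_nbrs_away (fun i n => softabs s n + (i%:R - (size x)%:R) ^+ 2 / (4 * s%:R) - potential s (y, x)) Es nyx).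
rewrite (tdistC y x) /potential /= (conflC y x) mE jE.
have -> : M%:R = M.-1%:R + 1 :> R by rewrite natr1 prednK // ltnW.
rewrite !natrD.
have -> : (size x + tdist x y).-1%:R = (size x)%:R + (tdist x y)%:R - 1 :> R.
  by rewrite -subn1 natrB ?natrD //; lia.
have := softabs_slope0 s0; have := softabs_second_diff _ s0; rewrite div1r.
have -> : s%:R^-1 = 4 * (4 * s%:R)^-1 :> R by field; rewrite gt_eqF.
have : 0 < (4 * s%:R)^-1 :> R by rewrite invr_gt0 mulr_gt0.
(* This balance fixes the factor 4: at distance [s], two inward jumps lower the squared term by
   [1 - 2 * k] in total, with [k] its coefficient, against a slope of [softabs] of at most 1. *)
have : (4 * s%:R)^-1 * s%:R = 4^-1 :> R by field; rewrite gt_eqF.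
set k := (4 * _)^-1 => ks k0 h4 h3.
rewrite -!natr1; set m := M.-1.
have m0 : 0 <= m%:R :> R := ler0n _ _.
have km : 0 <= k * m%:R by rewrite mulr_ge0 // ltW.
have h1 := softabs_nondecr s; have h2 := softabs_slope s.
have dlt : ~~ (tdist x y < s)%N -> (tdist x y)%:R = s%:R :> R.
  by rewrite -leqNgt => sD; suff -> : tdist x y = s by []; apply/eqP; rewrite eqn_leq Ds.
have dgt : ~~ (1 < tdist x y)%N -> (tdist x y)%:R = 1 :> R.
  by rewrite -leqNgt => D1; suff -> : tdist x y = 1%N by []; apply/eqP; rewrite eqn_leq D1.
(* At the root no parent is available: the first step of [softabs] replaces the second difference,
   and the terms linear in the distance have a nonpositive sum. *)
case: (size x) => [|n] /=.
  rewrite ?mul0r ?add0r subn0.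
  have := h2 0%N; have := h1 0%N.
  move: (softabs s 0) (softabs s 1) h3 => f0 f1 h3 h20 h10.
  case: (boolP (1 < _)%N) => [_|/dgt dE]; case: (boolP (_ < s)%N) => [_|/dlt dE'] //=; rewrite ?mulr1n ?mulr0n.
  - have kd : 0 <= k * (tdist x y)%:R by rewrite mulr_ge0 // ltW.
    lra.
  - rewrite -dE' in ks.
    have kd : 0 <= k * (tdist x y)%:R by rewrite mulr_ge0 // ltW.
    lra.
  - rewrite dE; lra.
  - lra.
have m1 : (1 <= m)%N by rewrite /m; lia.
rewrite (natrB _ m1) natrD.
have := h4 n; have := h1 n.+1; have := h1 n; have := h2 n.+1; have := h2 n.
move: (softabs s n) (softabs s n.+1) (softabs s n.+2) => f0 f1 f2.
rewrite -!natr1; move: (n%:R : R) => a.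
case: (boolP (1 < _)%N) => [_|/dgt dE]; case: (boolP (_ < s)%N) => [_|/dlt dE'] //=; rewrite ?mulr1n ?mulr0n.
- lra.
(* Stretched: only the jump of [x] toward [y] and that of [y] to its parent survive. *)
- rewrite -dE' in ks; lra.
(* Adjacent legs: the projection can only move up. *)
- rewrite dE; lra.
- by rewrite dE; lra.
Qed.

Lemma potential_drift (c : conf M) : valid_conf s c ->
  \sum_(z <- moves s c) (potential s z - potential s c) <= (M%:R + 2) / s%:R.
Proof.
case: c => x y /and4P[/= rx ry nxy Ds]; rewrite sum_moves.
rewrite [X in _ + X](_ : _ = leg_drift y x); last first.
  by apply: eq_bigr => z _; rewrite !(potentialC x).
rewrite -/(leg_drift x y).
have [pxy|nxyp] := boolP (prefix (rev x) (rev y)); first exact: drift_toward.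
have [pyx|nyxp] := boolP (prefix (rev y) (rev x)); last exact: drift_away.
by rewrite addrC; apply: drift_toward => //; rewrite 1?eq_sym // tdistC.
Qed.

(** The leg is within [s] of the projection, whose depth is dominated by [softabs]. *)
Lemma size_le_potential (c : conf M) : valid_conf s c ->
  (size c.1)%:R <= potential s c + s%:R.
Proof.
case: c => x y /and4P[/= rx ry nxy Ds]; rewrite /potential /=.
have h : (size x <= confl x y + s)%N.
  by have := confl_sizer x y; move: Ds; rewrite tdistE; lia.
apply: (@le_trans _ _ ((confl x y)%:R + s%:R)); first by rewrite -natrD ler_nat.
rewrite lerD2r; apply: le_trans (softabs_ge s _) _.
by rewrite lerDl divr_ge0 ?sqr_ge0 // mulr_ge0.
Qed.

End Drift.

(** * Convergence of the Euler scheme *)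

Section EulerScheme.
Context (R : realType).

Lemma bernoulli_ineq (y : R) m : 0 <= y <= 1 -> 1 - m%:R * y <= (1 - y) ^+ m.
Proof.
move=> /andP[y0 y1]; elim: m => [|m IH]; first by rewrite mul0r subr0 expr0.
rewrite exprS; have : (1 - y) * (1 - m%:R * y) <= (1 - y) * (1 - y) ^+ m.
  by rewrite ler_wpM2l // subr_ge0.
apply: le_trans; rewrite -natr1.
have : 0 <= m%:R * y ^+ 2 by rewrite mulr_ge0 ?sqr_ge0.
lra.
Qed.

(** With [x = b / m], multiplying [(1 - x) * expR x <= 1] by [1 + x] gives
    [expR x * (1 - x ^+ 2) <= 1 + x]; then take [m]-th powers and apply Bernoulli's inequality. *)
Lemma expR_le_compound (b : R) m : 0 <= b -> (0 < m)%N -> b <= m%:R ->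
  expR b * (1 - b ^+ 2 / m%:R) <= (1 + b / m%:R) ^+ m.
Proof.
move=> b0 m0 bm; have mp : 0 < m%:R :> R by rewrite ltr0n.
set x := b / m%:R.
have x0 : 0 <= x by rewrite divr_ge0 // ltW.
have x1 : x <= 1 by rewrite ler_pdivrMr // mul1r.
have bE : b = x * m%:R by rewrite /x divfK // gt_eqF.
have h1 : (1 - x) * expR x <= 1.
  have := expR_ge1Dx (- x); rewrite expRN => h.
  by rewrite -ler_pdivlMr ?expR_gt0 // div1r.
have h2 : expR x * (1 - x ^+ 2) <= 1 + x.
  have -> : expR x * (1 - x ^+ 2) = (1 + x) * ((1 - x) * expR x) by ring.
  by rewrite ler_piMr // addr_ge0.
have x2 : 0 <= x ^+ 2 <= 1 by rewrite sqr_ge0 expr_le1.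
apply: (@le_trans _ _ ((expR x * (1 - x ^+ 2)) ^+ m)); last first.
  by rewrite lerXn2r // nnegrE ?addr_ge0 // mulr_ge0 ?expR_ge0 // subr_ge0; case/andP: x2.
rewrite exprMn -expRM_natr -bE ler_wpM2l ?expR_ge0 //.
have -> : b ^+ 2 / m%:R = m%:R * x ^+ 2 by rewrite bE; field; rewrite gt_eqF.
exact: bernoulli_ineq.
Qed.

Lemma series_exp_coeff_le (b : R) n : 0 <= b -> series (exp_coeff b) n <= expR b.
Proof.
move=> b0; apply: nondecreasing_cvgn_le; last exact: is_cvg_series_exp_coeff.
by apply: nondecreasing_series => k _ _; rewrite /exp_coeff /= divr_ge0 ?exprn_ge0.
Qed.

Lemma euler_error (a : nat -> R) (B L t : R) m :
  0 <= t -> 0 <= L -> (forall n, `|a n| <= B * L ^+ n) ->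
  (0 < m)%N -> L * t <= m%:R ->
  `|series (fun n => t ^+ n / n`!%:R * a n) m.+1
    - \sum_(n < m.+1) 'C(m, n)%:R * (t / m%:R) ^+ n * a n|
  <= B * expR (L * t) * (L * t) ^+ 2 / m%:R.
Proof.
move=> t0 L0 aB m0 Ltm; set b := L * t.
have b0 : 0 <= b by rewrite mulr_ge0.
have mp : 0 < m%:R :> R by rewrite ltr0n.
have B0 : 0 <= B by have := aB 0%N; rewrite expr0 mulr1; apply: le_trans.
have binle n : 'C(m, n)%:R * (t / m%:R) ^+ n <= t ^+ n / n`!%:R :> R.
  rewrite expr_div_n mulrCA ler_wpM2l ?exprn_ge0 //.
  rewrite ler_pdivrMr ?exprn_gt0 // mulrC ler_pdivlMr ?ltr0n ?fact_gt0 //.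
  rewrite -natrM -natrX ler_nat bin_ffact.
  elim: n => [|n IH]; first by rewrite ffactn0.
  by rewrite ffactnSr expnSr leq_mul // leq_subr.
rewrite /series /= big_mkord -sumrB.
apply: le_trans (ler_norm_sum _ _ _) _.
apply: (@le_trans _ _ (\sum_(n < m.+1) B * ((t ^+ n / n`!%:R - 'C(m, n)%:R * (t / m%:R) ^+ n) * L ^+ n))).
  apply: ler_sum => n _; rewrite -mulrBl normrM ger0_norm ?subr_ge0 //.
  by rewrite mulrCA ler_wpM2l // subr_ge0.
rewrite -mulr_sumr -2!(mulrA B) ler_wpM2l //.
apply: (@le_trans _ _ (expR b - (1 + b / m%:R) ^+ m)); last first.
  by have := expR_le_compound b0 m0 Ltm; rewrite mulrBr mulr1 -mulrA; lra.
under eq_bigr do rewrite mulrBl.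
rewrite sumrB lerB //.
  rewrite [leLHS](_ : _ = series (exp_coeff b) m.+1) ?series_exp_coeff_le //.
  rewrite /series /= big_mkord; apply: eq_bigr => n _.
  by rewrite /exp_coeff /= exprMn mulrC mulrA.
rewrite exprDn le_eqVlt; apply/orP; left; apply/eqP; apply: eq_bigr => n _.
rewrite expr1n mul1r /b !exprMn -mulr_natl; ring.
Qed.
End EulerScheme.

(** * The generator and its semigroup *)

Section Generator.
Context (R : realType) (M s : nat).
Implicit Types (g f : conf M -> R) (c z y : conf M).

(** The generator acting on functions, with the diagonal term kept apart to match the recursion of
    [Qpow]. *)
Definition gen g c : R := - (size (moves s c))%:R * g c + \sum_(z <- moves s c) g z.

Lemma gen_sum (I : Type) (r : seq I) (k : I -> R) (G : I -> conf M -> R) c :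
  gen (fun c => \sum_(i <- r) k i * G i c) c = \sum_(i <- r) k i * gen (G i) c.
Proof.
rewrite /gen exchange_big mulr_sumr -big_split /=; apply: eq_bigr => i _.
by rewrite mulrDr mulr_sumr mulrCA.
Qed.

Lemma iter_gen_sum (I : Type) (r : seq I) (k : I -> R) (G : I -> conf M -> R) n c :
  iter n gen (fun c => \sum_(i <- r) k i * G i c) c =
  \sum_(i <- r) k i * iter n gen (G i) c.
Proof.
elim: n c => //= n IH c; rewrite -gen_sum; congr (gen _ c).
by apply/funext => z; exact: IH.
Qed.

Lemma Qpow_iter n c y : Qpow R s n c y = iter n gen (fun z => (z == y)%:R) c.
Proof.
elim: n c => //= n IH c; rewrite /gen IH; congr (_ + _).
by apply: eq_bigr => z _.
Qed.

Definition euler_step (h : R) g c : R := g c + h * gen g c.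

(** The binomial formula for the power of [1 + h Q], by Pascal's rule. *)
Lemma iter_euler_step h g m c :
  iter m (euler_step h) g c = \sum_(n < m.+1) 'C(m, n)%:R * h ^+ n * iter n gen g c.
Proof.
elim: m c => [|m IH] c; first by rewrite big_ord1 /= !mul1r.
rewrite iterS /euler_step.
have -> : iter m (euler_step h) g =
    (fun c => \sum_(n < m.+1) 'C(m, n)%:R * h ^+ n * iter n gen g c).
  by apply/funext => z; exact: IH.
rewrite gen_sum mulr_sumr.
rewrite [RHS]big_ord_recl [X in X + _]big_ord_recl /= !bin0 -addrA; congr (_ + _).
have -> : \sum_(i < m.+1) 'C(m.+1, bump 0 i)%:R * h ^+ bump 0 i * gen (iter i gen g) c =
  \sum_(i < m.+1) ('C(m, i.+1)%:R * h ^+ i.+1 * iter i.+1 gen g c +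
     h * ('C(m, i)%:R * h ^+ i * gen (iter i gen g) c)).
  by apply: eq_bigr => i _; rewrite /bump /= add1n binS natrD exprS /=; ring.
rewrite big_split /=; congr (_ + _).
by rewrite [RHS]big_ord_recr /= bin_small // !mul0r addr0.
Qed.

Context (M0 : (0 < M)%N).

(** At most [2 * M] jumps leave a configuration, so the diagonal and the off-diagonal part each
    contribute at most [2 * M] to the sup norm. *)
Lemma iter_gen_bound g (B : R) n c : (forall c, `|g c| <= B) ->
  `|iter n gen g c| <= B * (4 * M%:R) ^+ n.
Proof.
move=> gB; elim: n c => [|n IH] c; first by rewrite mulr1.
have B0 : 0 <= B * (4 * M%:R) ^+ n by apply: le_trans (IH c).
have szM : (size (moves s c))%:R <= 2 * M%:R :> R.
  by rewrite -natrM ler_nat size_moves.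
rewrite iterS /gen; apply: le_trans (ler_normD _ _) _.
apply: (@le_trans _ _ ((size (moves s c))%:R * (B * (4 * M%:R) ^+ n) +
    (size (moves s c))%:R * (B * (4 * M%:R) ^+ n))).
  apply: lerD; first by rewrite normrM normrN normr_nat ler_wpM2l.
  apply: le_trans (ler_norm_sum _ _ _) _.
  rewrite -sum1_size natr_sum mulr_suml; apply: ler_sum => z _.
  by rewrite mul1r.
have -> : B * (4 * M%:R) ^+ n.+1 = 4 * M%:R * (B * (4 * M%:R) ^+ n).
  by rewrite exprS; ring.
by rewrite -mulrDl ler_wpM2r //; lra.
Qed.

(* For [h] small the Euler step is a positive operator. *)
Lemma iter_euler_step_le (h e : R) g f m c :
  0 <= h -> h * (2 * M%:R) <= 1 ->
  (forall c, valid_conf s c -> gen f c <= e) ->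
  (forall c, valid_conf s c -> g c <= f c) ->
  valid_conf s c -> iter m (euler_step h) g c <= f c + m%:R * h * e.
Proof.
move=> h0 hM fe gf; elim: m c => [|m IH] c vc.
  by rewrite !mul0r addr0; apply: gf.
rewrite iterS /euler_step /gen.
set u := iter m _ g; set k := (size (moves s c))%:R.
have kM : h * k <= 1.
  by apply: le_trans hM; rewrite ler_wpM2l // -natrM ler_nat size_moves.
have h1 : (1 - h * k) * u c <= (1 - h * k) * (f c + m%:R * h * e).
  by rewrite ler_wpM2l ?subr_ge0 // IH.
have h2 : \sum_(z <- moves s c) u z <= \sum_(z <- moves s c) (f z + m%:R * h * e).
  rewrite big_seq [leRHS]big_seq; apply: ler_sum => z zc.
  by apply: IH; apply: moves_valid zc.
have h3 : \sum_(z <- moves s c) (f z + m%:R * h * e) =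
    \sum_(z <- moves s c) f z + k * (m%:R * h * e).
  by rewrite big_split /= (sum_cond_const _ true) mul1r.
have h4 : h * \sum_(z <- moves s c) u z <= h * (\sum_(z <- moves s c) f z + k * (m%:R * h * e)).
  by rewrite ler_wpM2l // -h3.
have := fe c vc; rewrite /gen -/k => h5.
have h6 : h * (- k * f c + \sum_(z <- moves s c) f z) <= h * e by rewrite ler_wpM2l.
rewrite -natr1; lra.
Qed.

(** Domination by the exponential series at [4 * M * t] shows that the limit defining [trans]
    exists; linearity then gives the semigroup on finitely supported functions. *)
Lemma cvg_trans_sum (Y : seq (conf M)) (k : conf M -> R) (t : R) c : 0 <= t ->
  series (fun n => t ^+ n / n`!%:R *
     iter n gen (fun z => \sum_(y <- Y) k y * (z == y)%:R) c) @ \oo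
  --> \sum_(y <- Y) k y * trans s t c y.
Proof.
move=> t0.
have cv y : series (fun n => t ^+ n / n`!%:R * Qpow R s n c y) @ \oo --> trans s t c y.
  apply: normed_cvg.
  apply: (@series_le_cvg _ _ (exp_coeff (4 * M%:R * t))); last exact: is_cvg_series_exp_coeff.
  - by move=> n /=; exact: normr_ge0.
  - by move=> n; rewrite /exp_coeff /= divr_ge0 ?exprn_ge0 // ?mulr_ge0.
  - move=> n /=; rewrite normrM ger0_norm ?divr_ge0 ?exprn_ge0 //.
    rewrite /exp_coeff /= exprMn (mulrC (_ ^+ n) (t ^+ n)) [leRHS]mulrAC.
    rewrite ler_wpM2l ?divr_ge0 ?exprn_ge0 //.
    rewrite Qpow_iter -[leRHS]mul1r; apply: iter_gen_bound => z.
    by case: (z == y); rewrite ?normr1 ?normr0.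
have -> : series (fun n => t ^+ n / n`!%:R *
     iter n gen (fun z => \sum_(y <- Y) k y * (z == y)%:R) c) =
   (fun N => \sum_(y <- Y) k y * series (fun n => t ^+ n / n`!%:R * Qpow R s n c y) N).
  apply/funext => N; rewrite /series /=.
  under [RHS]eq_bigr do rewrite mulr_sumr.
  rewrite [RHS]exchange_big /=; apply: eq_bigr => n _.
  rewrite iter_gen_sum mulr_sumr; apply: eq_bigr => y _.
  by rewrite Qpow_iter mulrCA.
elim: Y => [|y Y IH].
  by rewrite big_nil; under eq_fun do rewrite big_nil; exact: cvg_cst.
rewrite big_cons; under eq_fun do rewrite big_cons.
by apply: cvgD => //; apply: cvgMl_tmp; exact: cv.
Qed.

(** A Dynkin-type bound. As [f] may be unbounded, the semigroup is applied only to the truncation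
    [g] of [k] to [Y]; the Euler iterates of [g] stay below [f c + t * e], and so does their
    limit. *)
Lemma trans_sum_le (Y : seq (conf M)) (k f : conf M -> R) (t e : R) c : 0 <= t ->
  uniq Y -> (forall y, 0 <= k y) ->
  (forall c, valid_conf s c -> gen f c <= e) ->
  (forall c, valid_conf s c -> k c <= f c) ->
  valid_conf s c -> \sum_(y <- Y) k y * trans s t c y <= f c + t * e.
Proof.
move=> t0 uY k0 fe kf vc.
set g := fun z => \sum_(y <- Y) k y * (z == y)%:R.
have gE z : g z = if z \in Y then k z else 0.
  rewrite /g; case: ifPn => zY.
    rewrite (big_rem z) //= eqxx mulr1 big_seq big1 ?addr0 // => y.
    by rewrite mem_rem_uniq // inE => /andP[/= yz _]; rewrite eq_sym (negbTE yz) mulr0.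
  rewrite big_seq big1 // => y yY; case: eqP => [zy|]; rewrite ?mulr0 //.
  by rewrite zy yY in zY.
have gf z : valid_conf s z -> g z <= f z.
  move=> vz; rewrite gE; case: ifP => _; first exact: kf.
  exact: le_trans (k0 z) (kf z vz).
pose B := \sum_(y <- Y) k y.
have gB z : `|g z| <= B.
  rewrite gE; case: ifPn => zY; last by rewrite normr0 sumr_ge0.
  by rewrite ger0_norm // /B (big_rem z) //= lerDl sumr_ge0.
have L0 : 0 <= 4 * M%:R :> R by rewrite mulr_ge0.
pose K := B * expR (4 * M%:R * t) * (4 * M%:R * t) ^+ 2.
have cu := @cvg_trans_sum Y k t c t0.
set u := series _ in cu.
(* The scheme with [n.+1] steps has [n.+2] terms, hence the double shift. *)
have cu2 : (u k.+2 @[k --> \oo]) --> \sum_(y <- Y) k y * trans s t c y.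
  by rewrite (cvg_shiftS (fun k => u k.+1)) cvg_shiftS.
have cg : (f c + t * e + K * harmonic n @[n --> \oo]) --> f c + t * e + K * 0.
  by apply: cvgD; [exact: cvg_cst|apply: cvgMl_tmp; exact: cvg_harmonic].
rewrite mulr0 addr0 in cg.
apply: (ler_cvg_to cu2 cg).
near=> n.
(* Used both for the error bound and for the positivity of the Euler step. *)
have mt : 4 * M%:R * t <= n.+1%:R.
  by apply: (@le_trans _ _ n%:R); [near: n; exact: nbhs_infty_ger|rewrite ler_nat].
have := euler_error t0 L0 (fun n => iter_gen_bound n c gB) (ltn0Sn n) mt.
rewrite -iter_euler_step.
have np : 0 < n.+1%:R :> R by rewrite ltr0n.
have h0 : 0 <= t / n.+1%:R by rewrite divr_ge0.
have hM : t / n.+1%:R * (2 * M%:R) <= 1.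
  rewrite mulrAC ler_pdivrMr // mul1r; apply: le_trans mt.
  by rewrite mulrC ler_wpM2r // ler_wpM2r //; lra.
have := iter_euler_step_le n.+1 h0 hM fe gf vc.
have -> : n.+1%:R * (t / n.+1%:R) * e = t * e by field; rewrite gt_eqF.
rewrite -/g -/K => h1 /(le_trans (ler_norm _)).
rewrite lerBlDr => /le_trans; apply.
by rewrite addrC lerD2r.
Unshelve. all: by end_near.
Qed.

End Generator.

(** * Expectations and speed *)

Lemma nneseries_single (R : realType) (h : nat -> \bar R) m :
  (forall n, n != m -> h n = 0%E) -> (\sum_(n <oo) h n = h m)%E.
Proof.
move=> h0; apply: lim_near_cst => //; near=> N.
have mN : (m < N)%N by near: N; exists m.+1.
rewrite big_mkord (bigD1 (Ordinal mN)) //= big1 ?adde0 // => i im.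
exact: h0.
Unshelve. all: by end_near.
Qed.

Section CountableExpectation.
Context (d : measure_display) (T : measurableType d) (R : realType).
Context (P : probability T R) (I : countType) (X : T -> I) (k : I -> R).
Context (mX : forall y, measurable [set w | X w = y]) (k0 : forall y, 0 <= k y).

(** Only the fibres of [X] are known to be measurable, so [k (X w)] is expanded over the codes of
    elements of [I]; a number coding nothing contributes 0. *)
Local Notation term n w :=
  (oapp (fun y => (k y * \1_[set w | X w = y] w)%:E) 0%E (pickle_inv n)).

Let term_ge0 n w : (0 <= term n w)%E.
Proof.
by case: (pickle_inv n) => //= y; rewrite lee_fin mulr_ge0.
Qed.

Let measurable_term n : measurable_fun setT ((fun w => term n w) : T -> \bar R).
Proof.
case: (pickle_inv n) => [y|] /=; last exact: measurable_cst.
apply/measurable_EFinP; apply: measurable_funM; first exact: measurable_cst.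
exact: measurable_indic.
Qed.

Let sum_term w : (\sum_(n <oo) term n w = (k (X w))%:E)%E.
Proof.
rewrite (@nneseries_single _ _ (pickle (X w))).
  by rewrite pickleK_inv /= indicE mem_set // mulr1.
move=> n nX; case e : (pickle_inv n) => [y|] //=.
rewrite indicE memNset ?mulr0 //= => Xy; case/eqP: nX.
by have := @pickle_invK I n; rewrite e /= Xy.
Qed.

Lemma measurable_countable : measurable_fun setT ((fun w => (k (X w))%:E) : T -> \bar R).
Proof.
under eq_fun do rewrite -sum_term.
apply: ge0_emeasurable_sum => //.
Qed.

(** By monotone convergence a bound uniform over finite sets suffices, which is the form that
    [trans_sum_le] provides. *)
Lemma integral_countable_le (B : \bar R) :
  (forall Y : seq I, uniq Y -> (\sum_(y <- Y) (k y)%:E * P [set w | X w = y] <= B)%E) ->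
  (\int[P]_w (k (X w))%:E <= B)%E.
Proof.
move=> YB; under eq_integral do rewrite -sum_term.
rewrite integral_nneseries //.
apply: lime_le; first by apply: is_cvg_nneseries => n _ _; apply: integral_ge0.
apply: nearW => N; rewrite big_mkord.
have -> : (\sum_(n < N) \int[P]_w term n w =
   \sum_(y <- pmap (@pickle_inv I) (iota 0 N)) (k y)%:E * P [set w | X w = y])%E.
  rewrite big_pmap -(big_mkord xpredT (fun n => \int[P]_w term n w)%E) /index_iota subn0.
  apply: eq_bigr => n _; case: (pickle_inv n) => [y|] /=; last by rewrite integral0.
  rewrite (integralZl_indic measurableT (fun=> [set w | X w = y])) //.
    by rewrite integral_indic // setIT.
  by rewrite ltNge k0.
by apply: YB; rewrite (pmap_uniq (@pickle_invK I)) ?iota_uniq.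
Qed.

End CountableExpectation.

(** * Mean depth and speed of the spider *)

Section Spider.
Context (R : realType) (M s : nat) (M1 : (1 < M)%N) (s0 : (0 < s)%N).

Lemma gen_potential_le (c : conf M) : valid_conf s c ->
  gen s (fun c => potential R s c + s%:R) c <= (M%:R + 2) / s%:R.
Proof.
move=> vc; apply: le_trans (potential_drift _ M1 s0 vc).
rewrite /gen sumrB big_split /= !(sum_cond_const (moves s c) true) !mul1r.
by rewrite le_eqVlt; apply/orP; left; apply/eqP; ring.
Qed.

Context (d : measure_display) (Omega : measurableType d) (P : probability Omega R).
Context (x0 : conf M) (S : R -> Omega -> conf M).
Context (walk : spider_walk P s x0 S).

Lemma spider_law t y : 0 <= t -> P [set w | S t w = y] = (trans s t x0 y)%:E.
Proof.
move=> t0; case: walk => _ _ _ /(_ [:: t] [:: y] erefl).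
rewrite /= andbT t0 big_ord1 /= subr0 => /(_ isT) <-.
congr (P _); apply/seteqP; split => w /=; last by move/(_ 0%N isT).
by move=> Sy [].
Qed.

Definition start_cost : R := potential R s x0 + s%:R.

Lemma spider_mean_le t : 0 <= t ->
  (\int[P]_w (size (S t w).1)%:R%:E <= (start_cost + t * ((M%:R + 2) / s%:R))%:E)%E.
Proof.
move=> t0; have [vx mS _ _] := walk.
apply: (integral_countable_le (k := fun y => (size y.1)%:R)) => //.
  by move=> y; apply: mS.
move=> Y uY; under eq_bigr do rewrite spider_law // -EFinM.
rewrite sumEFin lee_fin /start_cost.
apply: (@trans_sum_le _ _ _ _ Y (fun y => (size y.1)%:R) (fun c => potential R s c + s%:R)) => //.
- exact: ltnW.
- by move=> c vc; apply: gen_potential_le.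
- by move=> c vc; apply: size_le_potential.
Qed.

Lemma spider_speed_bounds (v : R) :
  {ae P, forall w, (tdist (root_vertex M) (S t w).1)%:R / t @[t --> +oo] --> v} ->
  0 <= v <= (M%:R + 2) / s%:R.
Proof.
move=> [N [mN N0 Nv]].
have lim_v w : (~` N) w -> (size (S n%:R w).1)%:R / n%:R @[n --> \oo] --> v.
  move=> nNw; have : (tdist (root_vertex M) (S t w).1)%:R / t @[t --> +oo] --> v.
    by apply: contrapT => h; apply: nNw; apply: Nv.
  move=> /(cvg_comp _ _ cvgr_idn); apply: cvg_trans; apply: near_eq_cvg.
  by apply: nearW => n /=; rewrite tdist_root.
have PN : P (~` N) = 1%E by rewrite probability_setC // N0 sube0.
(* A single path outside the null set already gives [0 <= v]. *)
have [w nNw] : exists w, (~` N) w.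
  apply: contrapT => h; have : ~` N = set0.
    by apply/seteqP; split => // w nNw; case: h; exists w.
  by move=> N'; move: PN; rewrite N' measure0 => /eqP; rewrite eqe eq_sym oner_eq0.
have v0 : 0 <= v.
  by apply: (ler_cvg_to (cvg_cst 0) (lim_v w nNw)); apply: nearW => n; rewrite divr_ge0.
rewrite v0 /=; set b := _ / _.
have [_ mS _ _] := walk.
pose f n w : \bar R := ((n%:R^-1)%:E * ((size (S n%:R w).1)%:R)%:E)%E.
have msize n : measurable_fun setT ((fun w => ((size (S n%:R w).1)%:R)%:E) : Omega -> \bar R).
  by apply: (measurable_countable (k := fun y : conf M => (size y.1)%:R)) => // y; apply: mS.
have mf n : measurable_fun setT (f n).
  by apply: emeasurable_funM => //; exact: measurable_cst.
have f0 n w' : (0 <= f n w')%E by rewrite /f -EFinM lee_fin mulr_ge0 ?invr_ge0.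
(* Fatou's lemma along integer times, off the null set, where the lower limit of [f] is the constant
   [v]. *)
have := fatou P (measurableC mN) (fun n => measurable_funTS (mf n)) (fun n w' _ => f0 n w').
have -> : (\int[P]_(x in ~` N) limn_einf (f^~ x) = v%:E)%E.
  rewrite (eq_integral (cst v%:E)); first by rewrite (integral_cst P (measurableC mN)) -[RHS]mule1 -PN.
  move=> w' /[1!inE] /lim_v cv.
  have cE : f n w' @[n --> \oo] --> v%:E.
    apply: cvg_EFin; first by apply: nearW.
    by apply: cvg_trans cv; apply: near_eq_cvg; apply: nearW => n /=; rewrite mulrC.
  by rewrite (cvg_limn_einf_sup cE).1.
set u := fun n => _.
have ub n : (0 < n)%N -> (u n <= (start_cost * n%:R^-1 + b)%:E)%E.
  move=> n0; rewrite /u.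
  apply: (@le_trans _ _ (\int[P]_w f n w)%E).
    exact: (ge0_subset_integral P (measurableC mN) measurableT (mf n)).
  rewrite /f ge0_integralZl_EFin ?invr_ge0 //.
  apply: (@le_trans _ _ ((n%:R^-1)%:E * (start_cost + n%:R * b)%:E)%E).
    by rewrite lee_wpmul2l ?lee_fin ?invr_ge0 // spider_mean_le.
  rewrite -EFinM lee_fin mulrDr mulrA mulVf ?pnatr_eq0 -?lt0n // mul1r.
  by rewrite mulrC.
have cb : (start_cost * n%:R^-1 + b)%:E @[n --> \oo] --> b%:E.
  apply: cvg_EFin; first by apply: nearW.
  rewrite -[X in _ --> X]add0r; apply: cvgD; last exact: cvg_cst.
  rewrite -[X in _ --> X](mulr0 start_cost); apply: cvgMl_tmp.
  by rewrite -cvg_shiftS; exact: cvg_harmonic.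
(* Each tail infimum is at most its first term, which [ub] controls from [n = 1] on. *)
have ule : (limn_einf u <= b%:E)%E.
  rewrite limn_einf_lim.
  have ce : einfs u n @[n --> \oo] --> limn (einfs u) by apply: is_cvg_einfs.
  apply: (lee_cvg_to ce cb).
  near=> n; apply: (@le_trans _ _ (u n)); first by apply: ereal_inf_lbound; exists n => /=.
  by apply: ub; near: n; exists 1%N.
by move=> /le_trans/(_ ule); rewrite lee_fin.
Unshelve. all: by end_near.
Qed.

End Spider.

Theorem mainTheorem6 (R : realType) (M : nat) (hM : (3 <= M)%N) (V : nat -> R) :
  (forall s : nat, (2 <= s)%N ->
     exists (d : measure_display) (Omega : measurableType d)
            (P : probability Omega R) (x0 : conf M) (S : R -> Omega -> conf M),
       spider_walk P s x0 S /\
       {ae P, forall w, (tdist (root_vertex M) (S t w).1)%:R / t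
                          @[t --> +oo] --> V s}) ->
  V s @[s --> \oo] --> 0.
Proof.
move=> walks.
have bounds s : (2 <= s)%N -> 0 <= V s <= (M%:R + 2) / s%:R.
  move=> s2; case: (walks s s2) => ? [? [? [? [? [walk cvS]]]]].
  by apply: (spider_speed_bounds _ _ walk cvS); exact: ltnW.
apply: (squeeze_cvgr (f := fun=> 0) (h := fun s => (M%:R + 2) / s%:R)).
- by near=> s; apply: bounds; near: s; exists 2%N.
- exact: cvg_cst.
- rewrite -[X in _ --> X](mulr0 (M%:R + 2)); apply: cvgMl_tmp.
  by rewrite -cvg_shiftS; exact: cvg_harmonic.
Unshelve. all: by end_near.
Qed.
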